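(* $\overline{\mathscr{D}}'=\overline{\mathscr{D}}+1$, where $S'$ denotes the set of limit points of $S\subseteq\mathbb{R}$ and $S+1=\{s+1:s\in S\}$.
   Context: For a natural number $n$, $\|n\|$ denotes its integer complexity (the least number of $1$'s needed to write $n$ using $1$, $+$, $\cdot$ and parentheses), and $\delta(n)=\|n\|-3\log_3 n$ its defect. $\mathscr{D}=\{\delta(n):n\in\mathbb{N}\}$ and $\overline{\mathscr{D}}$ is its closure in $\mathbb{R}$. *)

(* Defs.v *)
From HB Require Import structures.
From mathcomp Require Import all_boot all_order all_algebra.
From mathcomp Require Import all_classical all_reals all_analysis.

Set Implicit Arguments.
Unset Strict Implicit.
Unset Printing Implicit Defensive.

Import Order.TTheory GRing.Theory Num.Theory.
Import numFieldNormedType.Exports.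

Inductive expr : Type :=
| One : expr
| Plus : expr -> expr -> expr
| Times : expr -> expr -> expr.

Fixpoint value (e : expr) : nat :=
  match e with
  | One => 1
  | Plus a b => value a + value b
  | Times a b => value a * value b
  end.

Fixpoint ones (e : expr) : nat :=
  match e with
  | One => 1
  | Plus a b => ones a + ones b
  | Times a b => ones a + ones b
  end.

Definition writable_with (n k : nat) : Prop :=
  exists e : expr, value e = n /\ ones e = k.

(* No expression has value 0, so complexity 0 is the junk value 0. *)
Definition complexity (n : nat) : nat :=
  match pselect (exists k, `[< writable_with n k >]) with
  | left h => ex_minn h
  | right _ => 0
  end.

Lemma complexityP (n : nat) : 0 < n ->
  writable_with n (complexity n) /\
  (forall k, writable_with n k -> complexity n <= k).
Proof.
move=> n_gt0.
have ex : exists k, `[< writable_with n k >].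
  case: n n_gt0 => // n _; elim: n => [|n [k /asboolP [e [ve oe]]]].
    by exists 1; apply/asboolP; exists One.
  exists k.+1; apply/asboolP; exists (Plus One e).
  by rewrite /= ve oe !add1n.
rewrite /complexity; case: pselect => [h|//].
by case: ex_minnP => m /asboolP wm mmin; split => // k wk; apply/mmin/asboolP.
Qed.

Local Open Scope ring_scope.
Local Open Scope classical_set_scope.

Definition defect (R : realType) (n : nat) : R :=
  (complexity n)%:R - 3 * (ln n%:R / ln 3).

(* The natural numbers here are the positive ones. *)
Definition defects (R : realType) : set R :=
  [set defect R n | n in [set n : nat | (0 < n)%N]].

Arguments defects : clear implicits.

(* Main.v *)
(** Let [E] ([excesses]) be the set of numbers [k - 3 log_3 n] with [k >= ||n||].
    It is closed under addition, and it turns out that [closure D = E] and [D' = E + 1].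

    [E' <= E + 1]: split an expression into its factors that are sums [a + b]
    with [a >= b]. A sum contributes [(k_a - 3 log_3 a) + k_b - 3 log_3 (1 + b/a)],
    and [b] is bounded when the defect is. If [a] is large, this is nearly an
    element of [E] plus [k_b >= 1]. If all the [a] are bounded, the defect is a
    natural combination of finitely many fixed nonnegative reals, and such
    combinations are discrete. Iterating [t |-> t - 1] shows that [E] is closed.

    [E + 1 <= D']: call [n] stable if [||3^i n|| = ||n|| + 3 i] for all [i]. If
    [3^k n + 1] had stable complexity less than [||n|| + 3 k + 1] for
    arbitrarily large [k], then [delta n] would be in [E'], hence [delta n - 1]
    in [E], which stability forbids. So the defects of the stable numbers
    [3^k n + 1] tend to [delta n + 1], and induction on [j] gives
    [delta n + j + 1] in [D']. *)

Require Import Defs.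
From HB Require Import structures.
From mathcomp Require Import all_boot all_order all_algebra.
From mathcomp Require Import all_classical all_reals all_analysis.
From mathcomp Require Import zify ring lra.

Import Order.TTheory GRing.Theory Num.Theory.
Import numFieldNormedType.Exports.

Local Open Scope ring_scope.
Local Open Scope classical_set_scope.

(** * Elementary bounds on integer complexity *)

Lemma value_gt0 (e : expr) : (0 < value e)%N.
Proof. by elim: e => [|a ha b hb|a ha b hb] //=; [lia|rewrite muln_gt0 ha]. Qed.

Lemma ones_gt0 (e : expr) : (0 < ones e)%N.
Proof. by elim: e => [|a ha b hb|a ha b hb] //=; lia. Qed.

Lemma complexity_value (e : expr) : (complexity (value e) <= ones e)%N.
Proof. by have [_ h] := complexityP (value_gt0 e); apply: h; exists e. Qed.

Lemma complexity_expr (n : nat) : (0 < n)%N ->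
  exists2 e : expr, value e = n & ones e = complexity n.
Proof. by move=> /complexityP [[e [ve oe]] _]; exists e. Qed.

Lemma complexityD (m n : nat) : (0 < m)%N -> (0 < n)%N ->
  (complexity (m + n) <= complexity m + complexity n)%N.
Proof.
move=> /complexity_expr [e <- <-] /complexity_expr [f <- <-].
exact: (complexity_value (Plus e f)).
Qed.

Lemma complexityM (m n : nat) : (0 < m)%N -> (0 < n)%N ->
  (complexity (m * n) <= complexity m + complexity n)%N.
Proof.
move=> /complexity_expr [e <- <-] /complexity_expr [f <- <-].
exact: (complexity_value (Times e f)).
Qed.

Lemma complexity1 : (complexity 1 <= 1)%N.
Proof. exact: (complexity_value One). Qed.

Lemma complexity_mul_exp3 (n k : nat) : (0 < n)%N ->
  (complexity (n * 3 ^ k) <= complexity n + 3 * k)%N.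
Proof.
move=> n0; elim: k => [|k ih]; first by rewrite expn0 muln1 muln0 addn0.
rewrite expnSr mulnA.
have h3 : (complexity 3 <= 3)%N.
  exact: (complexity_value (Plus One (Plus One One))).
have := @complexityM (n * 3 ^ k) 3; rewrite muln_gt0 n0 expn_gt0 /=.
by move=> /(_ isT isT); lia.
Qed.

(** For [b >= 2] the sum is at most the product [a * b], whose cube is already bounded; only [b = 1]
    needs care. *)
Lemma cube_addn_le (a b k l : nat) : (0 < a)%N -> (0 < b)%N -> (b <= a)%N ->
  (0 < k)%N -> (0 < l)%N -> (a ^ 3 <= 3 ^ k -> b ^ 3 <= 3 ^ l -> (a + b) ^ 3 <= 3 ^ (k + l))%N.
Proof.
move=> a0 b0 ba k0 l0 ak bl; rewrite expnD.
case: (ltnP 1 b) => b1.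
  apply: leq_trans (leq_mul ak bl); rewrite -expnMn leq_exp2r //; nia.
have -> : b = 1%N by lia.
have l3 : (3 <= 3 ^ l)%N by rewrite -{1}(expn1 3) leq_exp2l.
(* [(a + 1)^3 <= 3 a^3] holds from [a = 3] on; [a = 1] and [a = 2] are checked by hand. *)
case: (ltnP 2 a) => a2.
  apply: leq_trans (leq_mul ak l3).
  rewrite !expnS expn0; nia.
case: (ltnP 1 a) => a1; last first.
  have -> : a = 1%N by lia.
  by rewrite -expnD (@leq_trans (3 ^ 2)) // leq_exp2l //; lia.
have a_2 : a = 2%N by lia.
move: ak; rewrite a_2 => ak.
have k2 : (1 < k)%N by case: k ak {k0} => [|[|k]].
by rewrite -expnD (@leq_trans (3 ^ 3)) // leq_exp2l //; lia.
Qed.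

Lemma value_cube_le (e : expr) : (value e ^ 3 <= 3 ^ ones e)%N.
Proof.
elim: e => [|a ha b hb|a ha b hb] //=; last by rewrite expnMn expnD leq_mul.
have [ba|ab] := leqP (value b) (value a).
  by apply: cube_addn_le => //; rewrite ?value_gt0 ?ones_gt0.
rewrite addnC [X in (_ <= 3 ^ X)%N]addnC.
by apply: cube_addn_le => //; rewrite ?value_gt0 ?ones_gt0 // ltnW.
Qed.

Lemma complexity_cube_le (n : nat) : (0 < n)%N -> (n ^ 3 <= 3 ^ complexity n)%N.
Proof. by move=> /complexity_expr [e <- <-]; exact: value_cube_le. Qed.

(** * Stable numbers *)

Definition stable (n : nat) : Prop :=
  forall k : nat, (complexity n + 3 * k <= complexity (n * 3 ^ k))%N.

Lemma complexity_mul_exp3_ge (n k : nat) : (0 < n)%N ->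
  (3 * k <= complexity (n * 3 ^ k))%N.
Proof.
move=> n0; rewrite -(leq_exp2l (m := 3)) //.
apply: leq_trans (complexity_cube_le _ _); last by rewrite muln_gt0 n0 expn_gt0.
by rewrite mulnC expnM leq_exp2r // leq_pmull.
Qed.

(** Take [k] minimizing [||n 3^k|| - 3 k]; the preceding lower bound makes this truncated
    subtraction exact. *)
Lemma exists_stable (n : nat) : (0 < n)%N -> exists k, stable (n * 3 ^ k).
Proof.
move=> n0.
pose P d := `[< exists k, (complexity (n * 3 ^ k) - 3 * k)%N = d >].
have exP : exists d, P d.
  by exists (complexity (n * 3 ^ 0) - 3 * 0)%N; apply/asboolP; exists 0%N.
case: (ex_minnP exP) => d /asboolP [k kd] dmin; exists k => l.
have h : (d <= complexity (n * 3 ^ (k + l)) - 3 * (k + l))%N.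
  by apply: dmin; apply/asboolP; exists (k + l)%N.
have := @complexity_mul_exp3_ge n k n0; have := @complexity_mul_exp3_ge n (k + l) n0.
rewrite -mulnA -expnD; lia.
Qed.

(* The hypothesis says that [m] padded to [k] ones has defect [delta n - 1];
   then [m / n] is a power of 3, against the minimality of [delta n] among
   the defects of the [n 3^i]. *)
Lemma stable_defect_min (n m k : nat) : stable n -> (0 < n)%N -> (0 < m)%N ->
  (complexity m <= k)%N -> (n ^ 3 * 3 ^ k.+1 = m ^ 3 * 3 ^ complexity n)%N -> False.
Proof.
move=> stn n0 m0 mk e.
(* Compare the 3-adic valuations of the two sides of [e]. *)
have lognE : (3 * logn 3 n + k.+1 = 3 * logn 3 m + complexity n)%N.
  have L a c : (0 < a)%N -> (logn 3 (a ^ 3 * 3 ^ c) = 3 * logn 3 a + c)%N.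
    move=> a0; rewrite (@lognM 3 (a ^ 3) (3 ^ c)) ?expn_gt0 ?a0 //.
    by rewrite (lognX 3 a 3) (lognX 3 3 c) (@logn_prime 3 3) // muln1.
  by rewrite -!L // e.
have powE : (n * 3 ^ logn 3 m = m * 3 ^ logn 3 n)%N.
  apply/eqP; rewrite -(@eqn_exp2r _ _ 3) // -(@eqn_pmul2r (3 ^ k.+1)) ?expn_gt0 //.
  rewrite !expnMn -!expnM mulnAC e -!mulnA -!expnD.
  by apply/eqP; congr (m * (m * (m * 3 ^ _)))%N; lia.
(* Stability gives [||n|| + 3 v(m) <= k + 3 v(n)], whereas [lognE] makes the left side larger by
   one. *)
have := stn (logn 3 m); rewrite powE.
have := @complexity_mul_exp3 m (logn 3 n) m0; lia.
Qed.

(** * Arithmetic of excesses *)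

Definition excess (R : realType) (k n : nat) : R := k%:R - 3 * (ln n%:R / ln 3).

Definition excesses (R : realType) : set R :=
  [set y | exists k n : nat, [/\ (0 < n)%N, (complexity n <= k)%N & y = excess R k n]].

Section Excess.
Context {R : realType}.

Lemma ln3_gt0 : 0 < ln 3 :> R.
Proof. by apply: ln_gt0; rewrite ltr1n. Qed.

Lemma ln_natM (m n : nat) : (0 < m)%N -> (0 < n)%N ->
  ln (m * n)%:R = ln m%:R + ln n%:R :> R.
Proof. by move=> m0 n0; rewrite natrM lnM // posrE ltr0n. Qed.

Lemma ln_natX (m k : nat) : (0 < m)%N -> ln (m ^ k)%:R = k%:R * ln m%:R :> R.
Proof. by move=> m0; rewrite natrX lnXn ?ltr0n // mulr_natl. Qed.

Lemma excess_ge0 (k n : nat) : (0 < n)%N -> (complexity n <= k)%N -> 0 <= excess R k n.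
Proof.
move=> n0 nk.
have : (n ^ 3 <= 3 ^ k)%N.
  by apply: leq_trans (complexity_cube_le n n0) _; rewrite leq_exp2l.
rewrite -(ler_nat R) -ler_ln ?posrE ?ltr0n ?expn_gt0 ?n0 // !ln_natX // => h.
by rewrite /excess subr_ge0 mulrA ler_pdivrMr ?ln3_gt0.
Qed.

Lemma excessM (k l m n : nat) : (0 < m)%N -> (0 < n)%N ->
  excess R (k + l) (m * n) = excess R k m + excess R l n.
Proof. by move=> m0 n0; rewrite /excess ln_natM // natrD; ring. Qed.

Lemma excessDl (k j n : nat) : excess R (k + j) n = excess R k n + j%:R.
Proof. by rewrite /excess natrD; ring. Qed.

Lemma excess_mul_exp3 (k n i : nat) : (0 < n)%N ->
  excess R (k + 3 * i) (n * 3 ^ i) = excess R k n.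
Proof.
move=> n0; rewrite excessM ?expn_gt0 // /excess ln_natX // natrM.
by field; rewrite gt_eqF ?ln3_gt0.
Qed.

Lemma excessD (k l a b : nat) : (0 < a)%N ->
  excess R (k + l) (a + b) = excess R k a + l%:R - 3 * (ln (1 + b%:R / a%:R) / ln 3).
Proof.
move=> a0; have a0' : 0 < a%:R :> R by rewrite ltr0n.
rewrite /excess; have -> : (a + b)%:R = a%:R * (1 + b%:R / a%:R) :> R.
  by rewrite natrD; field; rewrite gt_eqF.
have r0 : 0 < 1 + b%:R / a%:R :> R by rewrite ltr_pwDl // divr_ge0 // ler0n.
by rewrite lnM ?posrE // natrD; ring.
Qed.

Lemma ln_1D_bounds (a b : nat) : (0 < a)%N ->
  0 <= ln (1 + b%:R / a%:R : R) / ln 3 <= (b%:R / a%:R) / ln 3.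
Proof.
move=> a0.
have r0 : 0 <= b%:R / a%:R :> R by rewrite divr_ge0 // ler0n.
rewrite divr_ge0 ?(ltW ln3_gt0) ?ln_ge0 ?lerDl //=.
by rewrite ler_pM2r ?invr_gt0 ?ln3_gt0 // le_ln1Dx // (lt_le_trans _ r0) ?ltrN10.
Qed.

Lemma defect_excess (n : nat) : defect R n = excess R (complexity n) n.
Proof. by []. Qed.

Lemma excesses_ge0 (y : R) : excesses R y -> 0 <= y.
Proof. by move=> [k [n [n0 nk ->]]]; apply: excess_ge0. Qed.

Lemma excess11 : excess R 1 1 = 1.
Proof. by rewrite /excess ln1 mul0r mulr0 subr0. Qed.

Lemma excessesD (x y : R) : excesses R x -> excesses R y -> excesses R (x + y).
Proof.
move=> [k [m [m0 mk ->]]] [l [n [n0 nl ->]]]; exists (k + l)%N, (m * n)%N.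
rewrite muln_gt0 m0 n0 excessM //; split => //.
by apply: leq_trans (complexityM m n m0 n0) _; apply: leq_add.
Qed.

Lemma excessesDnat (x : R) (j : nat) : excesses R x -> excesses R (x + j%:R).
Proof.
move=> [k [m [m0 mk ->]]]; exists (k + j)%N, m; rewrite excessDl; split => //.
by rewrite (leq_trans mk) ?leq_addr.
Qed.

Lemma defects_excesses : defects R `<=` excesses R.
Proof. by move=> _ [n n0 <-]; exists (complexity n), n. Qed.

(** * Discrete natural combinations, and large sums *)

Fixpoint nspan (F : seq R) (y : R) : Prop :=
  if F is f :: G then exists (n : nat) (z : R), nspan G z /\ y = n%:R * f + z
  else y = 0.

Lemma nspan0 (F : seq R) : nspan F 0.
Proof. by elim: F => [|f F ih] //=; exists 0%N, 0; rewrite mul0r addr0. Qed.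

Lemma nspanD (F : seq R) (x y : R) : nspan F x -> nspan F y -> nspan F (x + y).
Proof.
elim: F x y => [|f F ih] x y /=; first by move=> -> ->; rewrite addr0.
move=> [m [u [hu ->]]] [n [v [hv ->]]]; exists (m + n)%N, (u + v); split; first exact: ih.
by rewrite natrD; ring.
Qed.

Lemma nspan_mem (F : seq R) (x : R) : x \in F -> nspan F x.
Proof.
elim: F => // f F ih; rewrite inE => /orP [/eqP ->|/ih hx] /=.
  by exists 1%N, 0; split; [exact: nspan0|rewrite mul1r addr0].
by exists 0%N, x; rewrite mul0r add0r.
Qed.

Lemma nspan_ge0 (F : seq R) (y : R) : (forall f, f \in F -> 0 <= f) -> nspan F y -> 0 <= y.
Proof.
elim: F y => [|f F ih] y F0 /=; first by move=> ->.
move=> [n [z [hz ->]]]; apply: addr_ge0.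
  by rewrite mulr_ge0 ?ler0n // F0 ?mem_head.
by apply: ih hz => g gF; rewrite F0 // inE gF orbT.
Qed.

(** Induction on [F]. A zero generator changes nothing. If [f > 0], then [y < t + 1] bounds its
    coefficient, so only finitely many translates [t - n f] matter, and the least of their radii
    works. *)
Lemma nspan_isolated (F : seq R) : (forall f, f \in F -> 0 <= f) ->
  forall t : R, exists2 e : R, 0 < e & forall y, nspan F y -> `|y - t| < e -> y = t.
Proof.
elim: F => [|f F ih] F0 t /=.
  have [->|t0] := eqVneq t 0; first by exists 1 => // y ->.
  exists `|t|; first by rewrite normr_gt0.
  by move=> y ->; rewrite sub0r normrN ltxx.
have F0' g : g \in F -> 0 <= g by move=> gF; rewrite F0 // inE gF orbT.
have {}ih := ih F0'.
have := F0 f (mem_head _ _); rewrite le_eqVlt => /orP [/eqP f0|f0].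
  have [e e0 he] := ih t; exists e => // y [n [z [hz ->]]].
  by rewrite -f0 mulr0 add0r; exact: he.
have [N hN] : exists N : nat, (t + 1) / f < N%:R.
  by exists (Num.Def.trunc ((t + 1) / f)).+1; exact: truncnS_gt.
have [e e0 he] : exists2 e : R, 0 < e & forall (n : nat) z, (n < N)%N -> nspan F z ->
    `|n%:R * f + z - t| < e -> n%:R * f + z = t.
  elim: N {hN} => [|N [e e0 he]]; first by exists 1.
  have [d d0 hd] := ih (t - N%:R * f).
  exists (Num.min e d); first by rewrite lt_min e0 d0.
  move=> n z; rewrite ltnS leq_eqVlt lt_min => /orP [/eqP ->|nN] hz /andP [he' hd'].
    have -> : z = t - N%:R * f; last by ring.
    by apply: hd => //; rewrite opprB addrA [z + _]addrC.
  exact: he.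
exists (Num.min e 1); first by rewrite lt_min e0 ltr01.
move=> y [n [z [hz ->]]]; rewrite lt_min => /andP [hye hy1].
apply: he => //; rewrite ltnNge; apply/negP => Nn.
have z0 := nspan_ge0 _ _ F0' hz.
have : t + 1 < n%:R * f.
  rewrite ltr_pdivrMr // in hN; apply: lt_le_trans hN _.
  by rewrite ler_pM2r // ler_nat.
by move: hy1; rewrite ltr_norml => /andP [_]; lra.
Qed.

(* [large_sum M y]: [y] comes from a product having a factor [a + b] with
   [a > M]; the [k] ones are those of [b], and [x] collects everything else. *)
Definition large_sum (M : nat) (y : R) : Prop :=
  exists (x : R) (a b k : nat),
    [/\ excesses R x, (M < a)%N, (b <= a)%N, (b <= 3 ^ k)%N & (0 < k)%N] /\
    y = x + k%:R - 3 * (ln (1 + b%:R / a%:R) / ln 3).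

(** The range reaches [2 * M] because [b <= a <= M] gives [a + b <= 2 * M]. *)
Definition small_defects (M : nat) : seq R := [seq defect R n | n <- iota 1 (2 * M)].

Lemma large_sumD (M : nat) (x y : R) :
  large_sum M x -> excesses R y -> large_sum M (x + y).
Proof.
move=> [z [a [b [k [[hz Ma ba bk k0] ->]]]]] hy.
exists (z + y), a, b, k; split; last by ring.
by split=> //; exact: excessesD.
Qed.

(** Surplus ones are absorbed because 1 is itself a small defect, that of the number 1. *)
Lemma nspan_small (M k n : nat) : (0 < M)%N -> (0 < n <= 2 * M)%N ->
  (complexity n <= k)%N -> nspan (small_defects M) (excess R k n).
Proof.
move=> M0 nM nk; rewrite -(subnKC nk) excessDl -defect_excess; apply: nspanD.
  by apply/nspan_mem/map_f; rewrite mem_iota; lia.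
have d1 : nspan (small_defects M) 1.
  apply: nspan_mem; apply/mapP; exists 1%N; first by rewrite mem_iota; lia.
  suff c1 : complexity 1 = 1%N by rewrite defect_excess c1 excess11.
  apply/eqP; rewrite eqn_leq complexity1 /=.
  by have [e _ <-] := complexity_expr 1 isT; exact: ones_gt0.
elim: (k - _)%N => [|j ih]; first exact: nspan0.
by rewrite -addn1 natrD; exact: nspanD.
Qed.

Lemma excesses_expr (e : expr) : excesses R (excess R (ones e) (value e)).
Proof. by exists (ones e), (value e); rewrite value_gt0 complexity_value. Qed.

Lemma large_sum_plus (M : nat) (e f : expr) : (0 < M)%N -> (value f <= value e)%N ->
  large_sum M (excess R (ones e + ones f) (value e + value f)) \/
  nspan (small_defects M) (excess R (ones e + ones f) (value e + value f)).
Proof.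
move=> M0 fe; have [eM|Me] := leqP (value e) M; last first.
  left; exists (excess R (ones e) (value e)), (value e), (value f), (ones f).
  split; last by rewrite excessD ?value_gt0.
  split=> //; [exact: excesses_expr| |exact: ones_gt0].
  apply: leq_trans (value_cube_le f).
  by rewrite -{1}(expn1 (value f)) leq_pexp2l ?value_gt0.
right; apply: nspan_small => //; last exact: (complexity_value (Plus e f)).
by have := value_gt0 e; lia.
Qed.

(** In a product, one large factor suffices, the other joining the remainder [x]; two combinations
    add up. *)
Lemma large_sum_or_nspan_expr (M : nat) (e : expr) : (0 < M)%N ->
  large_sum M (excess R (ones e) (value e)) \/
  nspan (small_defects M) (excess R (ones e) (value e)).
Proof.
move=> M0; elim: e => [|e _ f _|e ihe f ihf] /=.
- by right; apply: nspan_small => //; [lia|exact: complexity1].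
- have [fe|/ltnW ef] := leqP (value f) (value e); first exact: large_sum_plus.
  by rewrite addnC [X in excess R _ X]addnC; exact: large_sum_plus.
- rewrite excessM ?value_gt0 //.
  case: ihe => [he|he]; first by left; apply: large_sumD => //; exact: excesses_expr.
  case: ihf => [hf|hf]; last by right; exact: nspanD.
  by left; rewrite addrC; apply: large_sumD => //; exact: excesses_expr.
Qed.

Lemma large_sum_or_nspan (M : nat) (y : R) : (0 < M)%N -> excesses R y ->
  large_sum M y \/ nspan (small_defects M) y.
Proof.
move=> M0 [k [n [n0 nk ->]]]; have [e ve oe] := complexity_expr n n0.
have h1 : excesses R 1.
  by exists 1%N, 1%N; rewrite complexity1 excess11.
rewrite -(subnKC nk) excessDl -oe -ve.
elim: (k - _)%N => [|j ih]; first by rewrite addr0; exact: large_sum_or_nspan_expr.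
rewrite -addn1 natrD addrA; case: ih => h; first by left; exact: large_sumD.
right; apply: nspanD => //.
by rewrite -excess11; apply: nspan_small; rewrite ?complexity1 //; lia.
Qed.

(** * Limit points of the excesses *)

Lemma limit_point_dist (A : set R) (t : R) :
  limit_point A t <-> forall e, 0 < e -> exists y, [/\ A y, y != t & `|y - t| < e].
Proof.
split=> [h e e0|h U /nbhs_ballP [e /= e0 eU]].
  have [y [yt Ay]] := h _ (nbhsx_ballx t e e0).
  by rewrite /ball /= distrC => ye; exists y.
have [y [Ay yt ye]] := h e e0; exists y; split => //.
by apply: eU; rewrite /ball /= distrC.
Qed.

Lemma closure_dist (A : set R) (t : R) :
  closure A t <-> forall e, 0 < e -> exists2 y, A y & `|y - t| < e.
Proof.
split=> [h e e0|h U /nbhs_ballP [e /= e0 eU]].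
  have [y [Ay]] := h _ (nbhsx_ballx t e e0).
  by rewrite /ball /= distrC => ye; exists y.
have [y Ay ye] := h e e0; exists y; split => //.
by apply: eU; rewrite /ball /= distrC.
Qed.

(* Near a limit point [t] only large sums occur, and there the bounded [b]
   contributes [k - o(1)]. *)
Lemma limit_point_excesses_closure (t : R) :
  limit_point (excesses R) t -> closure (excesses R) (t - 1).
Proof.
move=> /limit_point_dist ht; apply/closure_dist => e e0.
pose c : R := 3 / ln 3.
have c0 : 0 < c by rewrite divr_gt0 ?ln3_gt0.
(* For [y = x + k - l] with [x >= 0], [l <= c] and [y < t + 1], this forces [k < K], hence [b <= B];
   then [a > M] makes the logarithmic loss [l] less than [e / 2]. *)
pose K := (Num.Def.trunc (t + 1 + c)).+1.
have hK : t + 1 + c < K%:R by exact: truncnS_gt.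
pose B := (3 ^ K)%N.
pose M := (Num.Def.trunc (c * B%:R / (e / 2))).+1.
have hM : c * B%:R / (e / 2) < M%:R by exact: truncnS_gt.
have F0 f : f \in small_defects M -> 0 <= f.
  move=> /mapP [n]; rewrite mem_iota => n0 ->.
  by rewrite defect_excess excess_ge0 //; lia.
have [d d0 hd] := nspan_isolated (small_defects M) F0 t.
have [|y [Ey yt]] := ht (Num.min (Num.min (e / 2) 1) d).
  by rewrite !lt_min divr_gt0 ?ltr01.
rewrite !lt_min => /andP [/andP [ye y1] yd].
have [] := large_sum_or_nspan M y isT Ey; last first.
  by move=> /hd /(_ yd) yE; rewrite yE eqxx in yt.
move=> [x [a [b [k [[Ex Ma ba bk k0] yE]]]]].
have a0 : (0 < a)%N by lia.
have a0' : 0 < a%:R :> R by rewrite ltr0n.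
have /andP [l0 l1] := ln_1D_bounds a b a0.
set l := 3 * (ln _ / _) in yE.
have {}l0 : 0 <= l by rewrite /l mulr_ge0.
have {}l1 : l <= c * (b%:R / a%:R).
  rewrite /l /c -[leRHS]mulrA ler_pM2l // [leRHS]mulrC.
  by apply: le_trans l1 _; rewrite lexx.
have lc : l <= c.
  apply: le_trans l1 _; rewrite -[leRHS]mulr1 ler_pM2l // ler_pdivrMr // mul1r.
  by rewrite ler_nat.
have x0 := excesses_ge0 x Ex.
move: y1; rewrite ltr_norml => /andP [_ y1].
have kK : (k < K)%N by rewrite -(ltr_nat R); lra.
have bB : (b <= B)%N.
  by apply: leq_trans bk _; rewrite leq_exp2l // ltnW.
have le : l < e / 2.
  apply: le_lt_trans l1 _; rewrite mulrA ltr_pdivrMr //.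
  rewrite ltr_pdivrMr ?divr_gt0 // in hM.
  apply: (@le_lt_trans _ _ (c * B%:R)); first by rewrite ler_pM2l // ler_nat.
  apply: lt_trans hM _; rewrite mulrC ltr_pM2l ?divr_gt0 //.
  by rewrite ltr_nat.
exists (x + (k.-1)%:R); first exact: excessesDnat.
have kE : k%:R = (k.-1)%:R + 1 :> R by rewrite -{1}(prednK k0) -addn1 natrD.
move: ye; rewrite !ltr_norml => /andP [ye1 ye2].
by rewrite kE in yE; apply/andP; split; lra.
Qed.

(** Induction on an integer bound for [t]: a closure point is isolated, hence an excess, or a limit
    point, and then [t - 1] is a closure point. Nonnegativity stops the descent. *)
Lemma closed_excesses (t : R) : closure (excesses R) t -> excesses R t.
Proof.
have t0 s : closure (excesses R) s -> 0 <= s.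
  move=> /closure_dist hs; rewrite leNgt; apply/negP => s0.
  have [|y /excesses_ge0 y0] := hs (- s); first by rewrite oppr_gt0.
  by rewrite ltr_norml => /andP [_]; lra.
have [n] : exists n : nat, t < n%:R.
  by exists (Num.Def.trunc t).+1; exact: truncnS_gt.
elim: n t => [|n ih] t tn ht; first by have := t0 t ht; lra.
move: (ht); rewrite closure_isolated_limit_point.
move=> [/isolatedS //|/limit_point_excesses_closure h].
rewrite -(subrK 1 t); apply: (excessesDnat _ 1); apply: ih => //.
by rewrite ltrBlDr -natr1 in tn *.
Qed.

Lemma limit_point_excesses (t : R) : limit_point (excesses R) t -> excesses R (t - 1).
Proof. by move=> /limit_point_excesses_closure /closed_excesses. Qed.

(** * Limit points from the numbers [n * 3 ^ k + 1] *)

Lemma ln_1D_small (e : R) : 0 < e -> exists N : nat, forall a : nat, (N < a)%N ->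
  0 < 3 * (ln (1 + 1%:R / a%:R : R) / ln 3) < e.
Proof.
move=> e0; exists (Num.Def.trunc (3 / ln 3 / e)) => a Na.
have a0 : (0 < a)%N by lia.
have a0' : 0 < a%:R :> R by rewrite ltr0n.
have l3 := ln3_gt0.
apply/andP; split.
  rewrite mulr_gt0 // divr_gt0 // ln_gt0 // ltrDl divr_gt0 //.
have /andP [_ h] := ln_1D_bounds a 1 a0.
have : 3 / ln 3 / e < a%:R.
  by apply: lt_le_trans (truncnS_gt _) _; rewrite ler_nat.
rewrite ltr_pdivrMr // => h'.
apply: (@le_lt_trans _ _ (3 / ln 3 / a%:R)); last by rewrite ltr_pdivrMr // [ltRHS]mulrC.
by rewrite -mulrA ler_pM2l // (le_trans h) // mul1r mulrC.
Qed.

Lemma excess_mul_exp3_addn1 (k n i : nat) : (0 < n)%N ->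
  excess R (k + 3 * i) (n * 3 ^ i + 1) =
  excess R k n - 3 * (ln (1 + 1%:R / (n * 3 ^ i)%:R) / ln 3).
Proof.
move=> n0; rewrite -[(k + _)%N]addn0 excessD ?muln_gt0 ?n0 ?expn_gt0 //.
by rewrite excess_mul_exp3 // addr0.
Qed.

Lemma leq_mul_exp3 (n k : nat) : (0 < n)%N -> (k < n * 3 ^ k)%N.
Proof. by move=> n0; apply: leq_trans (ltn_expl k _) (leq_pmull _ n0). Qed.

Lemma stable_not_excesses (n : nat) : (0 < n)%N -> stable n ->
  ~ excesses R (excess R (complexity n) n - 1).
Proof.
move=> n0 sn [k [m [m0 mk e]]]; apply: (stable_defect_min n m k) => //.
have l3 := ln3_gt0.
have {}e : (k.+1)%:R * ln 3 + 3 * ln n%:R = (complexity n)%:R * ln 3 + 3 * ln m%:R :> R.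
  have kE : k%:R = (complexity n)%:R - 3 * (ln n%:R / ln 3) - 1 + 3 * (ln m%:R / ln 3) :> R.
    by move: e; rewrite /excess; lra.
  by rewrite -natr1 kE; field; rewrite gt_eqF.
apply/eqP; rewrite -(eqr_nat R); apply/eqP.
apply: ln_inj; rewrite ?posrE ?ltr0n ?muln_gt0 ?expn_gt0 ?n0 ?m0 //.
rewrite (ln_natM (n ^ 3)) ?(ln_natM (m ^ 3)) ?expn_gt0 ?n0 ?m0 //.
by rewrite (ln_natX n 3) // (ln_natX m 3) // !(ln_natX 3) //; lra.
Qed.

(* Otherwise [delta n] would be a limit point, so [delta n - 1] would be an
   excess. *)
Lemma stable_mul_exp3_addn1 (n : nat) : (0 < n)%N -> stable n ->
  exists K, forall k, (K <= k)%N -> stable (n * 3 ^ k + 1) /\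
    complexity (n * 3 ^ k + 1) = (complexity n + 3 * k + 1)%N.
Proof.
move=> n0 sn.
have n3 k : (0 < n * 3 ^ k)%N by rewrite muln_gt0 n0 expn_gt0.
(* The case [l = 0] yields the exact complexity, and the other [l] then yield stability. *)
suff [K hK] : exists K, forall k, (K <= k)%N -> forall l,
    (complexity n + 3 * k + 1 + 3 * l <= complexity ((n * 3 ^ k + 1) * 3 ^ l))%N.
  exists K => k /hK hk.
  have cE : complexity (n * 3 ^ k + 1) = (complexity n + 3 * k + 1)%N.
    have := hk 0%N; rewrite expn0 muln1.
    have := complexityD _ _ (n3 k) (ltn0Sn 0).
    have := complexity_mul_exp3 n k n0; have := complexity1; lia.
  by split=> // l; rewrite cE.
apply: contrapT => hK; apply: (stable_not_excesses n n0 sn).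
apply/limit_point_excesses/limit_point_dist => e /ln_1D_small [N hN].
have [k [Nk [l hl]]] : exists k, (N <= k)%N /\ exists l,
    (complexity ((n * 3 ^ k + 1) * 3 ^ l) <= complexity n + 3 * k + 3 * l)%N.
  apply: contrapT => h; apply: hK; exists N => k Nk l; rewrite leqNgt; apply/negP => hl.
  by apply: h; exists k; split=> //; exists l; lia.
have /andP [p0 pe] := hN (n * 3 ^ k)%N (leq_ltn_trans Nk (leq_mul_exp3 n k n0)).
exists (excess R (complexity n + 3 * k) (n * 3 ^ k + 1)).
rewrite excess_mul_exp3_addn1 //; split.
- exists (complexity n + 3 * k + 3 * l)%N, ((n * 3 ^ k + 1) * 3 ^ l)%N.
  have m0 : (0 < n * 3 ^ k + 1)%N by rewrite addn1.
  by rewrite excess_mul_exp3 // excess_mul_exp3_addn1 // muln_gt0 m0 expn_gt0.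
- by rewrite lt_eqF // gtrBl.
- by rewrite addrC addKr normrN gtr0_norm.
Qed.

Lemma limit_point_defect_addn (j n : nat) : (0 < n)%N -> stable n ->
  limit_point (defects R) (defect R n + j.+1%:R).
Proof.
elim: j n => [|j ih] n n0 sn; apply/limit_point_dist => e e0;
    have [K hK] := stable_mul_exp3_addn1 n n0 sn.
  have [N hN] := ln_1D_small e e0; set k := maxn K N.
  have [_ cE] := hK k (leq_maxl _ _).
  have /andP [p0 pe] := hN (n * 3 ^ k)%N (leq_ltn_trans (leq_maxr K N) (leq_mul_exp3 n k n0)).
  exists (defect R (n * 3 ^ k + 1)); split.
  - by exists (n * 3 ^ k + 1)%N => //=; rewrite addn1.
  - rewrite !defect_excess cE excessDl excess_mul_exp3_addn1 //.
    by rewrite lt_eqF // ltrD2r gtrBl.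
  - rewrite !defect_excess cE excessDl excess_mul_exp3_addn1 //.
    rewrite [X in `|X|](_ : _ = - (3 * (ln (1 + 1%:R / (n * 3 ^ k)%:R) / ln 3))); last by ring.
    by rewrite normrN gtr0_norm.
have [|N hN] := ln_1D_small (e / 2); first by rewrite divr_gt0.
set k := maxn K N.
have [sk cE] := hK k (leq_maxl _ _).
have /andP [] := hN (n * 3 ^ k)%N (leq_ltn_trans (leq_maxr K N) (leq_mul_exp3 n k n0)).
set p := 3 * _ => p0 pe.
have m0 : (0 < n * 3 ^ k + 1)%N by rewrite addn1.
(* The induction hypothesis is centred at the target minus [p], so a point within [p] of that centre
   lies strictly below the target and within [2 p < e] of it. *)
have [y [Dy yt ye]] := (limit_point_dist _ _).1 (ih (n * 3 ^ k + 1)%N m0 sk) p p0.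
move: yt ye; rewrite !defect_excess cE excessDl excess_mul_exp3_addn1 // -/p => yt.
have -> : j.+2%:R = j.+1%:R + 1 :> R by rewrite -natr1.
rewrite ltr_norml => /andP [y1 y2]; exists y; split=> //.
- by rewrite lt_eqF //; lra.
- by rewrite ltr_norml; apply/andP; split; lra.
Qed.

(** Multiplying by a power of 3 with three ones per factor keeps the excess and reaches a stable
    number; [j] counts the surplus ones. *)
Lemma excesses_stable (y : R) : excesses R y ->
  exists n j : nat, [/\ (0 < n)%N, stable n & y = defect R n + j%:R].
Proof.
move=> [k [m [m0 mk ->]]]; have [i si] := exists_stable m m0.
have h := complexity_mul_exp3 m i m0.
exists (m * 3 ^ i)%N, (k + 3 * i - complexity (m * 3 ^ i))%N; split=> //.
  by rewrite muln_gt0 m0 expn_gt0.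
rewrite defect_excess -excessDl subnKC ?excess_mul_exp3 //; lia.
Qed.

Lemma limit_point_defects (y : R) : excesses R y -> limit_point (defects R) (y + 1).
Proof.
move=> /excesses_stable [n [j [n0 sn ->]]]; rewrite -addrA natr1.
exact: limit_point_defect_addn.
Qed.

Lemma closure_defects : closure (defects R) = excesses R.
Proof.
apply/seteqP; split=> y.
  by move=> /(closureS defects_excesses) /closed_excesses.
move=> /excesses_stable [n [[|j] [n0 sn ->]]].
  by rewrite addr0; apply: subset_closure; exists n.
by apply: subset_limit_point; exact: limit_point_defect_addn.
Qed.

End Excess.

Theorem theorem1p8 (R : realType) :
  limit_point (closure (defects R)) = [set s + 1 | s in closure (defects R)].
Proof.
rewrite closure_defects; apply/seteqP; split=> [t /limit_point_excesses h|_ [s Es <-]].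
  by exists (t - 1) => //; rewrite subrK.
(* A limit point of the defects is one of the larger set of excesses. *)
move=> U /(limit_point_defects s Es) [y [yt Dy Uy]].
by exists y; split=> //; exact: defects_excesses.
Qed.
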